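(* Let $n\ge2$, $\mathsf{X}=\mathbb{R}^n$, $r_1>0$ and $r_2>1$. The average mechanism $M(x,\cdot)=\delta_{\bar{x}}$, where $\bar{x}=\frac1n\sum_{i=1}^n x_i$, satisfies $(\mathcal{I},\mathcal{G}_x^r,\kappa^r,0)$-PP with $\kappa^r=r_1+\log r_2$.
   Context: Scores: for a distribution $Q$ on $\mathbb{R}^n$ with marginal means $\mu_i(Q)$ and marginal variances $\sigma_i^2(Q)$, the $i$th marginal Dawid--Sebastiani score is $$D_i(Q,x)=\log\sigma_i^2(Q)+\frac{[x_i-\mu_i(Q)]^2}{\sigma_i^2(Q)},$$ and $\mathcal{I}=\{D_i\}_{i=1}^n$. Priors: for $\mu\in\mathbb{R}^n$ and positive-definite $\Sigma\in\mathbb{R}^{n\times n}$, write $\Sigma=\mathrm{diag}(\sigma)\,\Phi\,\mathrm{diag}(\sigma)$, with $\sigma=(\sigma_1,\dots,\sigma_n)$ the vector of marginal standard deviations and $\Phi$ the correlation matrix. Let $c_\Phi\in[1,\infty)$ be the condition number of $\Phi$ (largest eigenvalue over smallest eigenvalue), $\bar\mu=\frac1n\sum_i\mu_i$, and $\overline{\Sigma}=\frac1{n^2}\sum_{i,j}[\Sigma]_{ij}$. For $r=(r_1,r_2)$ and $x\in\mathbb{R}^n$, $$\mathcal{G}_x^r=\left\{\mathcal{N}(\mu,\Sigma):\ \frac{(\bar x-\bar\mu)^2}{\overline{\Sigma}}\le r_1,\quad c_\Phi\le r_2\left(1-\frac{\sigma_i^2}{\|\sigma\|_2^2}\right)\ \forall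 i\right\}.$$ Posterior: for $Q=\mathcal{N}(\mu,\Sigma)$, the posterior $Q_{\bar x}$ after observing the output $\bar x$ is the usual (degenerate) Gaussian conditional distribution of $X\sim Q$ given $\frac1n\sum_iX_i=\bar x$, with mean $\mu+\frac{\Sigma u}{u^\top\Sigma u}(\bar x-\bar\mu)$ and covariance $\Sigma-\frac{\Sigma uu^\top\Sigma}{u^\top\Sigma u}$, where $u=\frac1n(1,\dots,1)^\top$. Persuasive privacy: a mechanism $M$ (Markov kernel from $\mathsf{X}$ to an output space) is $(\mathcal{S},\mathcal{Q}_x,\kappa,\delta)$-PP if $$\inf_{S\in\mathcal{S}}\inf_{x\in\mathsf{X}}\inf_{Q\in\mathcal{Q}_x}\mathbb{P}_x\left[\Delta_S(Q,T,x)\le\kappa\right]\ge1-\delta,\qquad\Delta_S(Q,T,x)=S(Q,x)-S(Q_T,x),$$ where $\mathbb{P}_x$ is probability under $T\sim M(x,\cdot)$ and $Q_T$ is the posterior of $Q$ after observing $T$ (here $T=\bar x$). *)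

(* Defs.v *)
From HB Require Import structures.
From mathcomp Require Import all_boot all_order all_algebra.
From mathcomp Require Import all_classical all_reals all_analysis.
From mathcomp Require Import measurable_realfun ring.

Set Implicit Arguments.
Unset Strict Implicit.
Unset Printing Implicit Defensive.
Import Order.TTheory GRing.Theory Num.Theory.
Import numFieldNormedType.Exports.

Local Open Scope classical_set_scope.
Local Open Scope ring_scope.

(** * Persuasive privacy *)

(** [post Q t] is the posterior of the distribution [Q] on [X] after the
    output [t] of [M] has been observed.  It is a parameter because a
    conditional distribution is determined by [Q] and [M] only up to a null
    set of outputs, whereas the privacy guarantee is pointwise in [x]. *)
Definition persuasively_private (R : realType) (dX dY : measure_display)
    (X : measurableType dX) (Y : measurableType dY)
    (M : R.-pker X ~> Y) (post : probability X R -> Y -> probability X R)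
    (SS : set (probability X R -> X -> R)) (QQ : X -> set (probability X R))
    (kappa delta : R) : Prop :=
  (((1 - delta)%R)%:E <=
   ereal_inf [set ereal_inf [set ereal_inf
     [set M x [set t | (S Q x - S (post Q t) x <= kappa)%R] | Q in QQ x]
     | x in [set: X]] | S in SS])%E.

(** * Dawid--Sebastiani scores *)

Section scores.
Context {R : realType} {n : nat}.
Implicit Types (Q : probability (n.-tuple R) R) (x : n.-tuple R) (i : 'I_n).

Definition marginal_mean Q i : R := fine ('E_Q[fun y => tnth y i])%E.

Definition marginal_variance Q i : R := fine ('V_Q[fun y => tnth y i])%E.

Definition DS_score i Q x : R :=
  ln (marginal_variance Q i)
  + (tnth x i - marginal_mean Q i) ^+ 2 / marginal_variance Q i.

Definition DS_scores : set (probability (n.-tuple R) R -> n.-tuple R -> R) :=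
  [set DS_score i | i in [set: 'I_n]].

End scores.

(** * Gaussian distributions on R^n *)

(** The library's [normal_prob m 0] is the uniform distribution on [0, 1], not
    the point mass at [m]. *)
Definition normal_law {R : realType} (m v : R) : set R -> \bar R :=
  if v == 0 then \d_m else normal_prob m (Num.sqrt v).

(** [Q] is N(mu, Sigma): under [Q], every linear functional a^T X is normal
    with mean a^T mu and variance a^T Sigma a.  This covers singular [Sigma]. *)
Definition is_gaussian {R : realType} {n : nat}
    (Q : probability (n.-tuple R) R) (mu : 'cV[R]_n) (Sigma : 'M[R]_n) : Prop :=
  forall (a : 'cV[R]_n) (A : set R), measurable A ->
    Q ((fun y : n.-tuple R => \sum_i a i 0 * tnth y i) @^-1` A) =
    normal_law ((a^T *m mu) 0 0) ((a^T *m Sigma *m a) 0 0) A.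

Section covariance_matrices.
Context {R : realType} {n : nat}.
Implicit Types (A Sigma : 'M[R]_n).

Definition posdefmx A : Prop :=
  A^T = A /\ forall v : 'cV[R]_n, v != 0 -> 0 < (v^T *m A *m v) 0 0.

Definition stddev Sigma (i : 'I_n) : R := Num.sqrt (Sigma i i).

Definition corrmx Sigma : 'M[R]_n :=
  \matrix_(i, j) (Sigma i j / (stddev Sigma i * stddev Sigma j)).

(** A symmetric matrix has finitely many eigenvalues, all of them real, so that
    [sup] and [inf] are the largest and the smallest one. *)
Definition condition_number A : R :=
  sup [set l | eigenvalue A l] / inf [set l | eigenvalue A l].

End covariance_matrices.

(** ** Translates of normal laws *)

Lemma measurable_addr (R : realType) (c : R) :
  measurable_fun [set: R] (fun x : measurableTypeR R => x + c : measurableTypeR R).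
Proof. exact: measurable_funD. Qed.

Lemma lebesgue_measure_shift (R : realType) (c : R) (A : set R) : measurable A ->
  pushforward (@lebesgue_measure R)
    (fun x : measurableTypeR R => x + c : measurableTypeR R) A =
  lebesgue_measure A.
Proof.
move=> mA; apply/esym/lebesgue_measure_unique => //=.
  exact: measurable_addr.
move=> mphi _ [[a b]] _ <-.
rewrite /pushforward /=.
have -> : (fun x : R => x + c) @^-1` `]a, b] = `]a - c, b - c]%classic.
  by apply/seteqP; split=> x /=; rewrite !in_itv/= ltrBlDr lerBrDr.
rewrite !lebesgue_measure_itv/= !lte_fin ltrD2r; case: ifP => // _.
by rewrite -!EFinD opprB addrA subrK.
Qed.

Lemma normal_law_shift (R : realType) (m v c : R) (A : set R) :
  0 <= v -> measurable A ->
  normal_law m v ((fun z => z + c) @^-1` A) = normal_law (m + c) v A.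
Proof.
move=> v_ge0 mA; rewrite /normal_law; have [_|v0] := eqVneq v 0.
  by rewrite !diracE.
have s0 : Num.sqrt v != 0 by rewrite sqrtr_eq0 -ltNge lt0r v0.
rewrite /normal_prob.
transitivity (\int[pushforward (@lebesgue_measure R)
    (fun x : measurableTypeR R => (x + c)%R : measurableTypeR R)]_(x in A)
    (normal_pdf (m + c) (Num.sqrt v) x)%:E)%E; last first.
  apply: eq_measure_integral => /=.
    exact: measurable_addr.
  by move=> mphi B mB BA; rewrite lebesgue_measure_shift.
rewrite ge0_integral_pushforward.
- apply: eq_integral => x _ /=; congr (_%:E).
  rewrite !normal_pdfE//.
  by rewrite /normal_fun opprD addrACA subrr addr0.
- exact: measurable_addr.
- exact: mA.
- apply/measurable_EFinP; apply: measurable_funTS; exact: measurable_normal_pdf.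
- by move=> x _; rewrite lee_fin normal_pdf_ge0.
Qed.

(** * The average mechanism *)

Section average.
Context {R : realType} {n : nat}.
Implicit Types (x : n.-tuple R) (mu : 'cV[R]_n) (Sigma : 'M[R]_n).

Definition average x : R := n%:R^-1 * \sum_i tnth x i.

Lemma measurable_average : measurable_fun [set: n.-tuple R] average.
Proof.
apply: measurable_funM => //.
by apply: measurable_sum => i; exact: measurable_tnth.
Qed.

Definition average_mechanism : R.-pker (n.-tuple R) ~> R :=
  kdirac measurable_average.

Definition mean_average mu : R := n%:R^-1 * \sum_i mu i 0.

Definition variance_average Sigma : R :=
  (n%:R ^+ 2)^-1 * \sum_i \sum_j Sigma i j.

Definition gaussian_priors (r1 r2 : R) x :
    set (probability (n.-tuple R) R) :=
  [set Q | exists mu Sigma,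
    [/\ posdefmx Sigma, is_gaussian Q mu Sigma,
        (average x - mean_average mu) ^+ 2 / variance_average Sigma <= r1 &
        forall i, condition_number (corrmx Sigma) <=
          r2 * (1 - stddev Sigma i ^+ 2 / \sum_j stddev Sigma j ^+ 2)]].

Definition averaging_vector : 'cV[R]_n := const_mx n%:R^-1.
Local Notation u := averaging_vector.

Definition posterior_mean mu Sigma (t : R) : 'cV[R]_n :=
  mu + ((t - mean_average mu) / (u^T *m Sigma *m u) 0 0) *: (Sigma *m u).

Definition posterior_covariance Sigma : 'M[R]_n :=
  Sigma - ((u^T *m Sigma *m u) 0 0)^-1 *: (Sigma *m u *m u^T *m Sigma).

(** For [Q] = N(mu, Sigma), the conditional distribution of X ~ [Q] given that
    the average of X is [t]; an irrelevant default when [Q] is not a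
    nondegenerate Gaussian.  [average_posteriorP] shows that the default is
    never used otherwise. *)
Definition average_posterior (Q : probability (n.-tuple R) R) (t : R) :
    probability (n.-tuple R) R :=
  xget Q [set P | exists mu Sigma,
    [/\ posdefmx Sigma, is_gaussian Q mu Sigma &
        is_gaussian P (posterior_mean mu Sigma t)
                      (posterior_covariance Sigma)]].

Lemma averageE x : average x = \sum_i u i 0 * tnth x i.
Proof. by rewrite /average mulr_sumr; apply: eq_bigr => i _; rewrite mxE. Qed.

Lemma mean_averageE mu : mean_average mu = (u^T *m mu) 0 0.
Proof.
by rewrite /mean_average mulr_sumr mxE; apply: eq_bigr => i _; rewrite !mxE.
Qed.

Lemma quad_averaging_gt0 Sigma : (0 < n)%N -> posdefmx Sigma ->
  0 < (u^T *m Sigma *m u) 0 0.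
Proof.
move=> n0 [_]; apply; apply/eqP => /matrixP/(_ (Ordinal n0) 0).
by rewrite !mxE => /eqP; rewrite invr_eq0 pnatr_eq0 -leqn0 leqNgt n0.
Qed.

(** X + (t - average X) g with g = Sigma u / u^T Sigma u realizes the
    conditional distribution of X ~ N(mu, Sigma) given that the average is t. *)
Definition shift_along (g : 'cV[R]_n) (t : R) x : n.-tuple R :=
  [tuple tnth x i + (t - average x) * g i 0 | i < n].

Lemma measurable_shift_along g t :
  measurable_fun [set: n.-tuple R] (shift_along g t).
Proof.
apply/measurable_fun_tnthP => i.
rewrite (_ : _ \o _ = fun x => tnth x i + (t - average x) * g i 0); last first.
  by apply/funext => x /=; rewrite tnth_mktuple.
apply: measurable_funD; first exact: measurable_tnth.
apply: measurable_funM => //; apply: measurable_funB => //.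
exact: measurable_average.
Qed.

HB.instance Definition _ g t :=
  isMeasurableFun.Build _ _ _ _ _ (measurable_shift_along g t).

Lemma average_posterior_exists (Q : probability (n.-tuple R) R) mu Sigma t :
  (0 < n)%N -> posdefmx Sigma -> is_gaussian Q mu Sigma ->
  exists P : probability (n.-tuple R) R,
    is_gaussian P (posterior_mean mu Sigma t) (posterior_covariance Sigma).
Proof.
move=> n0 pd gQ; have w0 := quad_averaging_gt0 n0 pd.
set w := (_ *m u) 0 0 in w0.
pose g := w^-1 *: (Sigma *m u).
exists (distribution Q (shift_along g t)) => a A mA.
pose k := (a^T *m g) 0 0.
pose b := a - k *: u.
transitivity (Q ((fun y : n.-tuple R => \sum_i b i 0 * tnth y i) @^-1`
    ((fun z => z + k * t) @^-1` A))).
  rewrite /distribution /pushforward; congr (Q _); apply/seteqP.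
  suff E : forall y, \sum_i a i 0 * tnth (shift_along g t y) i =
      \sum_i b i 0 * tnth y i + k * t by split=> y /=; rewrite E.
  move=> y; have -> : \sum_i b i 0 * tnth y i =
      \sum_i a i 0 * tnth y i - k * average y.
    rewrite averageE mulr_sumr -sumrB; apply: eq_bigr => i _.
    by rewrite /b !mxE; ring.
  have -> : k = \sum_i a i 0 * g i 0.
    by rewrite /k mxE; apply: eq_bigr => i _; rewrite mxE.
  rewrite -addrA [- _ + _]addrC -mulrBr mulr_suml -big_split/=.
  by apply: eq_bigr => i _; rewrite tnth_mktuple; ring.
rewrite gQ; last first.
  by rewrite -[X in measurable X]setTI; apply: measurable_funD.
have qb0 : 0 <= (b^T *m Sigma *m b) 0 0.
  have [->|b0] := eqVneq b 0; first by rewrite mulmx0 mxE.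
  exact/ltW/pd.2.
rewrite (normal_law_shift _ _ qb0 mA).
have bT : b^T = a^T - k *: u^T by rewrite /b linearB linearZ.
have kE : (a^T *m Sigma *m u) 0 0 = k * w.
  rewrite /k /g -scalemxAr mulmxA [in RHS]mxE mulrC mulrA divff ?mul1r//.
  by rewrite gt_eqF.
have kE' : (u^T *m Sigma *m a) 0 0 = k * w.
  rewrite (_ : _ *m a = (a^T *m Sigma *m u)^T); first by rewrite mxE kE.
  by rewrite !trmx_mul trmxK pd.1 mulmxA.
have wE : (u^T *m Sigma *m u) 0 0 = w by [].
have wK : w != 0 by rewrite gt_eqF.
clearbody k w.
have hD (A1 B1 : 'M[R]_1) : (A1 + B1) 0 0 = A1 0 0 + B1 0 0 by rewrite mxE.
have hN (A1 : 'M[R]_1) : (- A1) 0 0 = - A1 0 0 by rewrite mxE.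
have hZ c (A1 : 'M[R]_1) : (c *: A1) 0 0 = c * A1 0 0 by rewrite mxE.
have hM (A1 B1 : 'M[R]_1) : (A1 *m B1) 0 0 = A1 0 0 * B1 0 0.
  by rewrite mxE big_ord1.
have -> : (a^T *m posterior_mean mu Sigma t) 0 0 = (b^T *m mu) 0 0 + k * t.
  rewrite /posterior_mean mean_averageE wE bT mulmxBl mulmxDr -scalemxAl.
  rewrite -scalemxAr mulmxA !(hD, hN, hZ) kE.
  rewrite mulrCA divfK// mulrBr; ring.
suff -> : (a^T *m posterior_covariance Sigma *m a) 0 0 =
  (b^T *m Sigma *m b) 0 0 by [].
rewrite bT /b !mulmxBl !mulmxBr -!scalemxAl -!scalemxAr.
rewrite /posterior_covariance wE mulmxBl -scalemxAl.
have -> : a^T *m (Sigma *m u *m u^T *m Sigma) *m a =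
    (a^T *m Sigma *m u) *m (u^T *m Sigma *m a) by rewrite !mulmxA.
rewrite !(hD, hN, hZ, hM) kE kE' wE; by field.
Qed.

Lemma average_posteriorP (Q : probability (n.-tuple R) R) mu Sigma t :
  (0 < n)%N -> posdefmx Sigma -> is_gaussian Q mu Sigma ->
  exists mu' Sigma', [/\ posdefmx Sigma', is_gaussian Q mu' Sigma' &
    is_gaussian (average_posterior Q t) (posterior_mean mu' Sigma' t)
                (posterior_covariance Sigma')].
Proof.
move=> n0 pd gQ; have [P gP] := average_posterior_exists t n0 pd gQ.
pose G (P : probability (n.-tuple R) R) := exists mu' Sigma',
  [/\ posdefmx Sigma', is_gaussian Q mu' Sigma' &
      is_gaussian P (posterior_mean mu' Sigma' t)
                    (posterior_covariance Sigma')].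
by apply: (@xgetPex _ Q G); exists P, mu, Sigma.
Qed.

End average.

(* Main.v *)
From HB Require Import structures.
Require Import Defs.
From mathcomp Require Import all_boot all_order all_algebra.
From mathcomp Require Import all_classical all_reals all_analysis.
From mathcomp Require Import measurable_realfun ring lra.
Import Order.TTheory GRing.Theory Num.Theory.
Import numFieldNormedType.Exports.

Set Implicit Arguments.
Unset Strict Implicit.
Unset Printing Implicit Defensive.

Local Open Scope classical_set_scope.
Local Open Scope ring_scope.

(** The output of the mechanism is deterministic, so the claim is that for every
    prior N(mu, Sigma), data x and coordinate i the score loss is at most
    r1 + ln r2.  Write z = x_i - mu_i, d for the deviation of the average of x
    from the average of mu, w = u^T Sigma u, c = (Sigma u)_i, V = Sigma_ii, and
    P = V - c^2 / w for the posterior variance.  The loss is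
      (ln V - ln P) + (z^2 / V - (z - c d / w)^2 / P).
    The quadratic part is at most d^2 / w, because the difference is the
    square (c z / V - d)^2 times V / (w P) ([score_loss_le]), and d^2 / w <= r1
    is a hypothesis on the prior.

    The logarithmic part needs V <= r2 P ([prior_le_posterior_variance]).  The
    posterior variance is the prior variance of the residual of X_i after
    regression on the average, P = b^T Sigma b with b = e_i - (c / w) u.  With
    sigma the vector of standard deviations and Phi the correlation matrix this
    is v^T Phi v for v_j = sigma_j b_j, that is, v = sigma_i e_i - t sigma for
    some number t.  The least eigenvalue of Phi bounds v^T Phi v from
    below by a multiple of |v|^2, and |v|^2 is at least the squared distance
    V (1 - V / |sigma|^2) from sigma_i e_i to the line spanned by sigma.  As Phi
    has unit diagonal, its largest eigenvalue is at least 1, so that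
    |v|^2 <= c_Phi v^T Phi v ([condition_number_quad]); the hypothesis
    on c_Phi then gives V <= r2 P.

    The scores only see the marginal means and variances of the laws.
    Since Gaussian laws are given by the laws of their linear functionals, these
    moments come from the second moment of N(0, s^2), obtained from an explicit
    antiderivative ([normal_pdf_second_moment]), and from a symmetry argument
    for the mean ([gaussian_expectation]).  They also show that the law
    determines mu and Sigma ([gaussian_inj]), so that the parameters from which
    the posterior is computed are those that the hypotheses bound. *)

(** * Symmetric matrices and their condition number *)

Section quadratic_forms.
Context {R : realType} {n : nat}.
Implicit Types (A : 'M[R]_n) (v w : 'rV[R]_n).

Lemma quadE A v :
  (v *m A *m v^T) 0 0 = \sum_i (\sum_j v 0 j * A j i) * v 0 i.
Proof. by rewrite mxE; apply: eq_bigr => i _; rewrite !mxE. Qed.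

Lemma sqnormE v : (v *m v^T) 0 0 = \sum_i v 0 i ^+ 2.
Proof. by rewrite mxE; apply: eq_bigr => i _; rewrite mxE expr2. Qed.

Lemma sqnorm_ge0 v : 0 <= (v *m v^T) 0 0.
Proof. by rewrite sqnormE sumr_ge0// => i _; rewrite sqr_ge0. Qed.

Lemma sqnorm_eq0 v : (v *m v^T) 0 0 = 0 -> v = 0.
Proof.
rewrite sqnormE => /eqP; rewrite psumr_eq0; last by move=> i _; exact: sqr_ge0.
move=> /allP v0; apply/rowP => i; rewrite mxE; apply/eqP.
by have := v0 i (mem_index_enum i); rewrite expf_eq0.
Qed.

Lemma sqnorm_gt0 v : v != 0 -> 0 < (v *m v^T) 0 0.
Proof.
move=> v0; rewrite lt_neqAle sqnorm_ge0 andbT eq_sym.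
by apply: contra_neq v0 => /sqnorm_eq0.
Qed.

Lemma quadZ A c v :
  ((c *: v) *m A *m (c *: v)^T) 0 0 = c ^+ 2 * (v *m A *m v^T) 0 0.
Proof. by rewrite linearZ/= -!scalemxAl -scalemxAr !mxE mulrA expr2. Qed.

Lemma sqnormZ c v :
  ((c *: v) *m (c *: v)^T) 0 0 = c ^+ 2 * (v *m v^T) 0 0.
Proof. by rewrite linearZ/= -scalemxAl -scalemxAr !mxE mulrA expr2. Qed.

Lemma continuous_quad A : continuous (fun v : 'rV[R]_n => (v *m A *m v^T) 0 0).
Proof.
under eq_fun do rewrite quadE.
apply: (continuous_big (op := +%R)); first exact: add_continuous.
move=> i _; pose f j (w : 'rV[R]_n) := w 0 j * A j i.
have cf : continuous (fun w => \sum_j f j w).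
  apply: (continuous_big (op := +%R)); first exact: add_continuous.
  move=> j _ w; apply: (@continuousM R 'rV[R]_n); first exact: coord_continuous.
  exact: cst_continuous.
move=> v; apply: (@continuousM R 'rV[R]_n); first exact: cf.
exact: coord_continuous.
Qed.

Lemma quadD A v w t : A^T = A ->
  ((v + t *: w) *m A *m (v + t *: w)^T) 0 0 =
  (v *m A *m v^T) 0 0 + 2 * t * (v *m A *m w^T) 0 0
  + t ^+ 2 * (w *m A *m w^T) 0 0.
Proof.
move=> As; have sw : (w *m A *m v^T) 0 0 = (v *m A *m w^T) 0 0.
  rewrite (_ : w *m A *m v^T = (v *m A *m w^T)^T); first by rewrite mxE.
  by rewrite !trmx_mul As trmxK mulmxA.
rewrite linearD linearZ/= !mulmxDl !mulmxDr -!scalemxAl -!scalemxAr.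
have hD (A1 B1 : 'M[R]_1) : (A1 + B1) 0 0 = A1 0 0 + B1 0 0 by rewrite mxE.
have hZ c (A1 : 'M[R]_1) : (c *: A1) 0 0 = c * A1 0 0 by rewrite mxE.
rewrite !(hD, hZ) sw; ring.
Qed.

(** Otherwise moving from [v] a little way along - [v *m A] would make the form
    negative. *)
Lemma psd_kernel A v : A^T = A -> (forall w, 0 <= (w *m A *m w^T) 0 0) ->
  (v *m A *m v^T) 0 0 = 0 -> v *m A = 0.
Proof.
move=> As psd v0; apply: sqnorm_eq0.
set w := v *m A; set p : R := (w *m w^T) 0 0.
set c : R := (w *m A *m w^T) 0 0.
have p0 : 0 <= p by exact: sqnorm_ge0.
have c0 : 0 <= c by exact: psd.
have c1 : 0 < c + 1 by rewrite ltr_wpDl.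
(* The form at v + t w is 2 t p + t^2 c; for p > 0 this value of t makes it
   negative, and dividing by c + 1 covers c = 0. *)
have := psd (v + (- p / (c + 1)) *: w).
rewrite quadD// v0 add0r -/w -/p -/c.
rewrite (_ : 2 * _ * p + _ = - (p ^+ 2 * ((c + 2) / (c + 1) ^+ 2))); last first.
  by field; rewrite gt_eqF.
rewrite oppr_ge0 pmulr_lle0; last by rewrite divr_gt0 ?exprn_gt0// ltr_wpDl.
move=> p2; have : p ^+ 2 == 0 by rewrite eq_le p2 sqr_ge0.
by rewrite expf_eq0 => /eqP.
Qed.

(** The Rayleigh quotient attains its minimum [m] because the unit sphere is
    compact; [A - m%:M] is then positive semidefinite and its form vanishes at
    the minimizer, which [psd_kernel] turns into an eigenvector. *)
Lemma min_eigenvalue A : (0 < n)%N -> A^T = A ->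
  exists2 m, eigenvalue A m &
    forall v, m * (v *m v^T) 0 0 <= (v *m A *m v^T) 0 0.
Proof.
move=> n0 As.
pose K := [set v : 'rV[R]_n | (v *m v^T) 0 0 = 1].
have cK : compact K.
  apply: bounded_closed_compact.
    exists 1; split; first exact: real1.
    move=> M M1 v /=; rewrite /K/= sqnormE => v1.
    rewrite [leLHS]/Num.norm/= mx_normrE; apply/bigmax_leP; split.
      by rewrite ltW// (lt_trans ltr01).
    move=> [i j] _ /=; rewrite ord1 (le_trans _ (ltW M1))//.
    rewrite -(@ler_pXn2r _ 2)// ?nnegrE// expr1n real_normK ?num_real// -v1.
    by rewrite (bigD1 j)//= lerDl sumr_ge0// => k _; rewrite sqr_ge0.
  rewrite (_ : K = (fun v : 'rV[R]_n => (v *m 1%:M *m v^T) 0 0) @^-1` [set 1]).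
    apply: closed_comp; last exact: closed_eq.
    by move=> ? _; exact: continuous_quad.
  by apply/seteqP; split => v; rewrite /K/= mulmx1.
have K0 : K !=set0.
  exists (delta_mx 0 (Ordinal n0)); rewrite /K/= sqnormE.
  rewrite (bigD1 (Ordinal n0))//= mxE !eqxx expr1n big1 ?addr0// => i i0.
  by rewrite mxE eqxx (negbTE i0) expr0n.
have [v /set_mem vK vmin] := EVT_min_rV K0 cK
  (continuous_subspaceT (continuous_quad (A := A))).
set m := (v *m A *m v^T) 0 0 in vmin.
have mle w : m * (w *m w^T) 0 0 <= (w *m A *m w^T) 0 0.
  have [->|w0] := eqVneq w 0; first by rewrite !mul0mx mxE mulr0.
  have q0 := sqnorm_gt0 w0; set q := _ 0 0 in q0 *.
  pose s := Num.sqrt q; have s0 : 0 < s by rewrite sqrtr_gt0.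
  have sE : s ^+ 2 = q by rewrite sqr_sqrtr// ltW.
  have := vmin (s^-1 *: w); rewrite quadZ => H.
  rewrite -ler_pdivlMr// mulrC -sE -exprVn H// inE /K/=.
  by rewrite sqnormZ -/q exprVn sE mulVf ?gt_eqF.
exists m => //.
have v0 : v != 0.
  apply/eqP => v0; move: vK; rewrite /K/= v0 mul0mx mxE => /eqP.
  by rewrite eq_sym oner_eq0.
apply/eigenvalueP; exists v => //; apply/eqP.
rewrite -subr_eq0 -mul_mx_scalar -mulmxBr.
have hB w : (w *m (A - m%:M) *m w^T) 0 0 =
    (w *m A *m w^T) 0 0 - m * (w *m w^T) 0 0.
  by rewrite mulmxBr mulmxBl mul_mx_scalar -scalemxAl !mxE.
apply/eqP/psd_kernel.
- by rewrite linearB/= As tr_scalar_mx.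
- by move=> w; rewrite hB subr_ge0.
- by rewrite hB vK mulr1 subrr.
Qed.

Lemma eigenvalueN A l : eigenvalue (- A) l -> eigenvalue A (- l).
Proof.
move=> /eigenvalueP[v vA v0]; apply/eigenvalueP; exists v => //.
by rewrite scaleNr -vA mulmxN opprK.
Qed.

(** The least eigenvalue [m] satisfies m |v|^2 <= v A v^T, and the greatest one
    is at least 1, since it bounds the value [A i i = 1] of the form at a unit
    vector; so |v|^2 <= (1 / m) v A v^T <= (greatest / m) v A v^T. *)
Lemma condition_number_quad A i v : posdefmx A -> A i i = 1 ->
  (v *m v^T) 0 0 <= condition_number A * (v *m A *m v^T) 0 0.
Proof.
move=> [As pd] Aii.
have n0 : (0 < n)%N by case: n i {A v As pd Aii} => // -[].
have [m em mle] := min_eigenvalue n0 As.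
(* The greatest eigenvalue of A is - M, with M the least one of - A. *)
have [M /eigenvalueN eM MN] : exists2 M, eigenvalue (- A) M &
    forall v, M * (v *m v^T) 0 0 <= (v *m (- A) *m v^T) 0 0.
  by apply: min_eigenvalue => //; rewrite linearN/= As.
have Mle w : (w *m A *m w^T) 0 0 <= - M * (w *m w^T) 0 0.
  by rewrite -lerN2 mulNr opprK (le_trans (MN w))// mulmxN mulNmx mxE.
have eigE l : eigenvalue A l -> exists2 w : 'rV[R]_n, w != 0 &
    (w *m A *m w^T) 0 0 = l * (w *m w^T) 0 0.
  by move=> /eigenvalueP[w wA w0]; exists w => //; rewrite wA -scalemxAl mxE.
have pd' (w : 'rV[R]_n) : w != 0 -> 0 < (w *m A *m w^T) 0 0.
  by move=> w0; rewrite -{1}[w]trmxK pd// trmx_eq0.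
have m0 : 0 < m.
  have [w w0 wE] := eigE _ em.
  by have := pd' _ w0; rewrite wE pmulr_lgt0// sqnorm_gt0.
have M1 : 1 <= - M.
  have := Mle (delta_mx 0 i); rewrite trmx_delta -rowE mul_delta_mx -colE.
  by rewrite !mxE !eqxx Aii mulr1.
have infm : m <= inf [set l | eigenvalue A l].
  apply: lb_le_inf; first by exists m.
  move=> l /eigE[w w0 wE]; have := mle w.
  by rewrite wE ler_pM2r// sqnorm_gt0.
have supM : - M <= sup [set l | eigenvalue A l].
  apply: ub_le_sup => //; exists (- M) => l /eigE[w w0 wE].
  by have := Mle w; rewrite wE ler_pM2r// sqnorm_gt0.
have infle : inf [set l | eigenvalue A l] <= m.
  apply: ge_inf => //; exists 0 => l /eigE[w w0 wE]; have := pd' _ w0.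
  by rewrite wE pmulr_lgt0 ?sqnorm_gt0// => /ltW.
have -> : condition_number A = sup [set l | eigenvalue A l] / m.
  by rewrite /condition_number; congr (_ / _); apply/eqP; rewrite eq_le infle.
rewrite mulrAC ler_pdivlMr// mulrC (le_trans (mle v))//.
rewrite ler_peMl ?(le_trans M1)//.
by rewrite (le_trans _ (mle v))// mulr_ge0 ?sqnorm_ge0// ltW.
Qed.

End quadratic_forms.

(** * Prior and posterior variances *)

Section covariance.
Context {R : realType} {n : nat}.
Implicit Types (A Sigma : 'M[R]_n) (v : 'rV[R]_n) (i : 'I_n).

Lemma posdefmx_quad A v : posdefmx A -> v != 0 -> 0 < (v *m A *m v^T) 0 0.
Proof. by move=> [_ pd] v0; rewrite -{1}[v]trmxK pd// trmx_eq0. Qed.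

Lemma quad_delta A i :
  (delta_mx 0 i *m A *m (delta_mx 0 i)^T : 'M[R]_1) 0 0 = A i i.
Proof. by rewrite trmx_delta -rowE -colE !mxE. Qed.

Lemma posdefmx_diag Sigma i : posdefmx Sigma -> 0 < Sigma i i.
Proof.
move=> pd; rewrite -quad_delta posdefmx_quad//; apply/eqP => /rowP/(_ i).
by rewrite !mxE !eqxx => /eqP; rewrite oner_eq0.
Qed.

Lemma stddev_gt0 Sigma i : posdefmx Sigma -> 0 < stddev Sigma i.
Proof. by move=> pd; rewrite sqrtr_gt0 posdefmx_diag. Qed.

Lemma sqr_stddev Sigma i : posdefmx Sigma -> stddev Sigma i ^+ 2 = Sigma i i.
Proof. by move=> pd; rewrite sqr_sqrtr// ltW// posdefmx_diag. Qed.

Lemma corrmx_quad Sigma v : posdefmx Sigma ->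
  let s := \row_j (stddev Sigma j * v 0 j) in
  (s *m corrmx Sigma *m s^T) 0 0 = (v *m Sigma *m v^T) 0 0.
Proof.
move=> pd s; rewrite !quadE; apply: eq_bigr => i _.
rewrite mulr_suml [RHS]mulr_suml; apply: eq_bigr => j _; rewrite !mxE.
by field; rewrite !gt_eqF ?stddev_gt0.
Qed.

Lemma corrmx_posdef Sigma : posdefmx Sigma -> posdefmx (corrmx Sigma).
Proof.
move=> pd; split=> [|v v0].
  apply/matrixP => i j; rewrite !mxE [stddev _ _ * _]mulrC; congr (_ / _).
  by rewrite -[in RHS]pd.1 mxE.
pose w := \row_j (v j 0 / stddev Sigma j).
have vE : v^T = \row_j (stddev Sigma j * w 0 j).
  by apply/rowP => j; rewrite !mxE mulrCA divff ?mulr1// gt_eqF ?stddev_gt0.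
rewrite -{2}[v]trmxK vE corrmx_quad// posdefmx_quad//.
apply: contra_neq v0 => w0; apply: trmx_inj; rewrite vE trmx0; apply/rowP => j.
by rewrite w0 !mxE mulr0.
Qed.

Lemma corrmx_diag Sigma i : posdefmx Sigma -> corrmx Sigma i i = 1.
Proof.
by move=> pd; rewrite mxE -expr2 sqr_stddev// divff// gt_eqF// posdefmx_diag.
Qed.

Local Notation u := (averaging_vector : 'cV[R]_n).

Lemma variance_averageE Sigma :
  variance_average Sigma = (u^T *m Sigma *m u) 0 0.
Proof.
rewrite /variance_average -{2}[u]trmxK quadE exchange_big/= mulr_sumr.
apply: eq_bigr => j _; rewrite mulr_sumr mulr_suml; apply: eq_bigr => i _.
by rewrite !mxE -exprVn; ring.
Qed.

Lemma posterior_variance Sigma i : posdefmx Sigma ->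
  posterior_covariance Sigma i i =
  Sigma i i - (Sigma *m u) i 0 ^+ 2 / (u^T *m Sigma *m u) 0 0.
Proof.
move=> pd; rewrite /posterior_covariance.
have -> : Sigma *m u *m u^T *m Sigma = Sigma *m u *m (Sigma *m u)^T.
  by rewrite trmx_mul pd.1 !mulmxA.
move: (_ *m u : 'cV[R]_n) ((_ *m u : 'M[R]_1) 0 0) => c w.
by rewrite !mxE big_ord1 !mxE mulrC expr2.
Qed.

(** The posterior variance of X_i is the prior variance of the residual
    X_i - k average X, where k is the regression coefficient. *)
Lemma posterior_variance_residual Sigma i : (0 < n)%N -> posdefmx Sigma ->
  let k := (Sigma *m u) i 0 / (u^T *m Sigma *m u) 0 0 in
  let b : 'rV[R]_n := delta_mx 0 i + (- k) *: u^T in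
  (b *m Sigma *m b^T) 0 0 = posterior_covariance Sigma i i.
Proof.
move=> n0 pd k b; have w0 := quad_averaging_gt0 n0 pd.
rewrite quadD ?pd.1// trmxK quad_delta posterior_variance//.
have -> : (delta_mx 0 i *m Sigma *m u : 'M[R]_1) 0 0 = (Sigma *m u) i 0.
  by rewrite -mulmxA -rowE mxE.
by rewrite /k; field; rewrite gt_eqF.
Qed.

(** The rescaled residual is sigma_i e_i - t sigma with t = k / n; the
    right-hand side is thus at least the squared distance from sigma_i e_i to
    the line spanned by sigma. *)
Lemma sqnorm_scaled_residual_ge Sigma i k : posdefmx Sigma ->
  let v := \row_j (stddev Sigma j *
    (delta_mx 0 i + (- k) *: u^T : 'rV[R]_n) 0 j) in
  Sigma i i * (1 - Sigma i i / \sum_j stddev Sigma j ^+ 2) <= (v *m v^T) 0 0.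
Proof.
move=> pd /=; set v := \row_j _.
set N := \sum_j _; pose t := k / n%:R.
have Nsplit : N = Sigma i i + \sum_(j | j != i) stddev Sigma j ^+ 2.
  by rewrite /N (bigD1 i)//= sqr_stddev.
have N0 : 0 < N.
  rewrite Nsplit ltr_pwDl ?posdefmx_diag// sumr_ge0// => j _; exact: sqr_ge0.
have -> : (v *m v^T) 0 0 = Sigma i i - 2 * t * Sigma i i + t ^+ 2 * N.
  rewrite sqnormE Nsplit (bigD1 i)//= !mxE !eqxx exprMn sqr_stddev//.
  rewrite mulrDr [t ^+ 2 * _ in RHS]mulrC mulr_sumr addrA; congr (_ + _).
    by rewrite /t /=; ring.
  by apply: eq_bigr => j ji; rewrite !mxE (negbTE ji) exprMn /t /=; ring.
rewrite -subr_ge0.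
rewrite (_ : _ - _ = N * (t - Sigma i i / N) ^+ 2); last first.
  by field; rewrite gt_eqF.
by rewrite mulr_ge0 ?sqr_ge0// ltW.
Qed.

Lemma diag_lt_total_variance Sigma i : (1 < n)%N -> posdefmx Sigma ->
  Sigma i i < \sum_j stddev Sigma j ^+ 2.
Proof.
move=> n1 pd; rewrite (bigD1 i)//= sqr_stddev// ltrDl.
have sq0 j : j != i -> 0 <= stddev Sigma j ^+ 2 by rewrite sqr_ge0.
rewrite lt_neqAle sumr_ge0// andbT eq_sym psumr_neq0//.
have [j ji] : exists j : 'I_n, j != i.
  have /card_gt1P[x [y [_ _ xy]]] : (1 < #|'I_n|)%N by rewrite card_ord.
  have [xi|] := eqVneq x i; last by exists x.
  by exists y; rewrite eq_sym -xi.
apply/hasP; exists j; first exact: mem_index_enum.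
by rewrite ji exprn_gt0// stddev_gt0.
Qed.

(** With q = 1 - sigma_i^2 / |sigma|^2 > 0 and P the posterior variance,
    Sigma_ii q <= |v|^2 <= c_Phi P <= r q P for the rescaled residual v. *)
Lemma prior_le_posterior_variance Sigma (r : R) i :
  (1 < n)%N -> posdefmx Sigma ->
  (forall i, condition_number (corrmx Sigma) <=
     r * (1 - stddev Sigma i ^+ 2 / \sum_j stddev Sigma j ^+ 2)) ->
  Sigma i i <= r * posterior_covariance Sigma i i.
Proof.
move=> n1 pd /(_ i); rewrite sqr_stddev//; set q := 1 - _ => hc.
have PE := posterior_variance_residual i (ltnW n1) pd.
move: PE => /=; set k := _ / _; set b := _ + _ => PE.
have lo := sqnorm_scaled_residual_ge i k pd.
move: lo => /=; set v := \row_j _; rewrite -/q => lo.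
have hi := condition_number_quad v (corrmx_posdef pd) (corrmx_diag i pd).
rewrite corrmx_quad// PE in hi.
have V0 := posdefmx_diag i pd; have ltN := diag_lt_total_variance i n1 pd.
have q0 : 0 < q by rewrite subr_gt0 ltr_pdivrMr ?mul1r// (lt_trans V0).
have P0 : 0 < posterior_covariance Sigma i i.
  rewrite -PE posdefmx_quad//; apply/eqP => b0.
  have v0 : v = 0 by apply/rowP => j; rewrite mxE -/b b0 !mxE mulr0.
  by have := lo; rewrite v0 mul0mx mxE leNgt mulr_gt0.
rewrite -(ler_pM2r q0) (le_trans lo)// (le_trans hi)//.
by rewrite [leRHS]mulrAC ler_pM2r.
Qed.

End covariance.

(** The right-hand side exceeds the left one by (c z / V - d)^2 V / (w P). *)
Lemma score_loss_le (R : realType) (V P w c z d : R) :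
  0 < V -> 0 < w -> 0 < P -> P = V - c ^+ 2 / w ->
  z ^+ 2 / V - (z - c * d / w) ^+ 2 / P <= d ^+ 2 / w.
Proof.
move=> V0 w0 P0 PE.
have VE : V = P + c ^+ 2 / w by rewrite PE subrK.
rewrite -subr_ge0.
rewrite (_ : _ - _ = (c * z / V - d) ^+ 2 * V / (w * P)); last first.
  have D0 : P * w + c ^+ 2 != 0.
    by rewrite gt_eqF// ltr_wpDr ?sqr_ge0// mulr_gt0.
  by rewrite VE; field; rewrite D0 !gt_eqF//.
by apply: divr_ge0; apply: mulr_ge0; rewrite ?sqr_ge0// ltW.
Qed.

(** * The second moment of a normal law *)

Section normal_second_moment.
Context {R : realType}.
Local Notation mu := (@lebesgue_measure R).

(** The density is a version of the Radon-Nikodym derivative, as both have the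
    same integral over every measurable set. *)
Lemma ge0_integral_normal_prob (m s : R) (f : R -> \bar R) :
  measurable_fun [set: R] f -> (forall x, 0 <= f x)%E ->
  (\int[normal_prob m s]_x f x = \int[mu]_x (f x * (normal_pdf m s x)%:E))%E.
Proof.
move=> mf f0; have dom := normal_prob_dominates m s.
rewrite -(Radon_Nikodym_SigmaFinite.change_of_variables dom)//.
set g := Radon_Nikodym_SigmaFinite.f _ _.
have gi : mu.-integrable [set: R] g.
  exact: Radon_Nikodym_SigmaFinite.f_integrable.
have mpdf : measurable_fun [set: R] (fun x => (normal_pdf m s x)%:E).
  by apply/measurable_EFinP; exact: measurable_normal_pdf.
apply: ae_eq_integral => //.
- by apply: emeasurable_funM => //; exact: measurable_int gi.
- exact: emeasurable_funM.
- apply: ae_eqe_mul2l; apply: integral_ae_eq => // E _ mE.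
  by rewrite -Radon_Nikodym_SigmaFinite.f_integral.
Qed.

Context (s : R) (s0 : 0 < s).
Let phi := normal_pdf 0 s.

Let phiE x : phi x = normal_peak s * expR (- (s ^+ 2 *+ 2)^-1 * x ^+ 2).
Proof.
rewrite /phi normal_pdfE ?gt_eqF// /normal_fun subr0.
by congr (_ * expR _); ring.
Qed.

Let dphi (x : R) : is_derive x 1 phi (- (x / s ^+ 2) * phi x).
Proof.
rewrite (funext phiE); apply: is_derive_eq.
by rewrite /=/GRing.scale/=; field; rewrite gt_eqF.
Qed.

(* H' = (s^2 - x^2) phi: up to the vanishing boundary term H, x^2 and s^2 have
   the same integral against phi. *)
Let H (x : R) : R := s ^+ 2 * x * phi x.

Let dH (x : R) : is_derive x 1 H ((s ^+ 2 - x ^+ 2) * phi x).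
Proof.
have dp := dphi x; rewrite /H; apply: is_derive_eq.
by rewrite /=/GRing.scale/=; field; rewrite gt_eqF.
Qed.

Let continuous_phi : continuous phi.
Proof. by apply: continuous_normal_pdf; rewrite gt_eqF. Qed.

Let continuous_polyphi (a b : R) :
  continuous (fun x : R => (a * x ^+ 2 + b) * phi x).
Proof.
move=> x; apply: cvgM; last exact: continuous_phi.
apply: cvgD; last exact: cvg_cst.
by apply: cvgM; [exact: cvg_cst|exact: exprn_continuous].
Qed.

Let continuous_H : continuous H.
Proof.
move=> x; apply/differentiable_continuous/derivable1_diffP.
by have [] := dH x.
Qed.

(* From exp(y) >= y with y = x^2 / (2 s^2), H x is at most a constant over x. *)
Let cvgH : H x @[x --> +oo] --> 0.
Proof.
have M0 := normal_peak_gt0 (lt0r_neq0 s0).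
pose K := s ^+ 2 * normal_peak s * (s ^+ 2 *+ 2).
apply: (@squeeze_cvgr _ _ _ _ (cst 0) (fun x => K * x^-1)).
- near=> x; have x0 : 0 < x by near: x; exact: nbhs_pinfty_gt.
  apply/andP; split.
    by rewrite /H !mulr_ge0 ?sqr_ge0 ?normal_pdf_ge0// ltW.
  rewrite /H phiE mulNr expRN; set e := expR _.
  rewrite (_ : _ * _ = s ^+ 2 * normal_peak s * (x * e^-1)); last by ring.
  have -> : K / x = s ^+ 2 * normal_peak s * ((s ^+ 2 *+ 2) / x).
    by rewrite /K mulrA.
  apply: ler_wpM2l; first by rewrite mulr_ge0 ?sqr_ge0 ?(ltW M0).
  have y0 : 0 < (s ^+ 2 *+ 2)^-1 * x ^+ 2.
    by rewrite mulr_gt0 ?exprn_gt0// invr_gt0 pmulrn_lgt0 ?exprn_gt0.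
  rewrite (@le_trans _ _ (x * ((s ^+ 2 *+ 2)^-1 * x ^+ 2)^-1))//.
    rewrite ler_wpM2l ?(ltW x0)// lef_pV2 ?posrE ?expR_gt0//.
    by rewrite (le_trans _ (expR_ge1Dx _))// lerDr.
  rewrite le_eqVlt; apply/orP; left; apply/eqP.
  by field; rewrite !gt_eqF.
- exact: cvg_cst.
- rewrite -[X in _ --> X](mulr0 K); apply: cvgMl_tmp.
  by apply/gtr0_cvgV0; [near=> x; near: x; exact: nbhs_pinfty_gt|exact: cvg_id].
Unshelve. all: by end_near. Qed.

(** By symmetry it suffices to integrate over the positive half-line.  The
    derivative (s^2 - x^2) phi of H changes sign at s, so the half-line is cut
    at s to keep both integrands nonnegative; the boundary terms are H s on both
    sides and cancel. *)
Lemma normal_pdf_second_moment :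
  (\int[mu]_x (x ^+ 2 * normal_pdf 0 s x)%:E = (s ^+ 2)%:E)%E.
Proof.
have cq := @continuous_polyphi 1 0; have cs := @continuous_polyphi 0 (s ^+ 2).
have qE : (fun x => (1 * x ^+ 2 + 0) * phi x) = (fun x => x ^+ 2 * phi x).
  by apply/funext => x; rewrite mul1r addr0.
have sE : (fun x => (0 * x ^+ 2 + s ^+ 2) * phi x) = (fun x => s ^+ 2 * phi x).
  by apply/funext => x; rewrite mul0r add0r.
rewrite {}qE in cq; rewrite {}sE in cs.
have mq := continuous_measurable_fun cq.
have ms := continuous_measurable_fun cs.
have phi0 x : 0 <= phi x by exact: normal_pdf_ge0.
have q0 x : 0 <= x ^+ 2 * phi x by rewrite mulr_ge0 ?sqr_ge0.
have s20 x : 0 <= s ^+ 2 * phi x by rewrite mulr_ge0 ?sqr_ge0.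
have phiN x : phi (- x) = phi x by rewrite !phiE sqrrN.
have F x : derivable H x 1 by have [] := dH x.
have inner : (\int[mu]_(x in `[0%R, s]) (s ^+ 2 * phi x)%:E =
    \int[mu]_(x in `[0%R, s]) (x ^+ 2 * phi x)%:E + (H s)%:E)%E.
  have <- : (\int[mu]_(x in `[0%R, s]) ((s ^+ 2 - x ^+ 2) * phi x)%:E =
      (H s)%:E)%E.
    rewrite (@continuous_FTC2 _ _ H)//.
    - by rewrite {2}/H mulr0 mul0r sube0.
    - have := @continuous_polyphi (-1) (s ^+ 2).
      rewrite (_ : (fun _ => _) = (fun x => (s ^+ 2 - x ^+ 2) * phi x)).
        exact: continuous_subspaceT.
      by apply/funext => x; rewrite mulN1r addrC.
    - split => [x _//||].
      + exact/cvg_at_right_filter/continuous_H.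
      + exact/cvg_at_left_filter/continuous_H.
    - by move=> x _; rewrite derive1E; have [] := dH x.
  rewrite -ge0_integralD//=.
  - by apply: eq_integral => x _; rewrite -EFinD -mulrDl subrKC.
  - by move=> x _; rewrite lee_fin.
  - exact/measurable_EFinP/measurable_funTS.
  - move=> x; rewrite in_itv/= => /andP[x0 xs].
    by rewrite lee_fin mulr_ge0// subr_ge0 ler_pXn2r// nnegrE// ltW.
  - apply/measurable_EFinP/measurable_funTS; rewrite (_ : (fun _ => _) =
      (fun x => s ^+ 2 * phi x) \- (fun x => x ^+ 2 * phi x)).
      exact: measurable_funB.
    by apply/funext => x /=; rewrite mulrBl.
have outer : (\int[mu]_(x in `[s, +oo[) (x ^+ 2 * phi x)%:E =
    \int[mu]_(x in `[s, +oo[) (s ^+ 2 * phi x)%:E + (H s)%:E)%E.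
  have <- : (\int[mu]_(x in `[s, +oo[) ((x ^+ 2 - s ^+ 2) * phi x)%:E =
      (H s)%:E)%E.
    rewrite (@ge0_continuous_FTC2y _ _ (\- H) _ 0)//.
    - by rewrite sub0e -EFinN opprK.
    - move=> x sx; rewrite mulr_ge0// subr_ge0 ler_pXn2r// ?nnegrE ?ltW//.
      exact: lt_le_trans sx.
    - have := @continuous_polyphi 1 (- s ^+ 2).
      rewrite (_ : (fun _ => _) = (fun x => (x ^+ 2 - s ^+ 2) * phi x)).
        exact: continuous_subspaceT.
      by apply/funext => x; rewrite mul1r.
    - by rewrite -oppr0; exact: cvgN cvgH.
    - by move=> x _; apply: derivableN.
    - by apply: cvgN; exact/cvg_at_right_filter/continuous_H.
    - move=> x _; rewrite derive1E deriveN//; have [_ ->] := dH x.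
      by rewrite -mulNr opprB.
  rewrite -ge0_integralD//=.
  - by apply: eq_integral => x _; rewrite -EFinD -mulrDl subrKC.
  - by move=> x _; rewrite lee_fin.
  - exact/measurable_EFinP/measurable_funTS.
  - move=> x; rewrite in_itv/= andbT => sx.
    rewrite lee_fin mulr_ge0// subr_ge0 ler_pXn2r// ?nnegrE ?ltW//.
    exact: lt_le_trans sx.
  - apply/measurable_EFinP/measurable_funTS; rewrite (_ : (fun _ => _) =
      (fun x => x ^+ 2 * phi x) \- (fun x => s ^+ 2 * phi x)).
      exact: measurable_funB.
    by apply/funext => x /=; rewrite mulrBl.
have split (f : R -> R) : (forall x, 0 <= f x) -> measurable_fun [set: R] f ->
   (\int[mu]_(x in `[0%R, +oo[) (f x)%:E =
     \int[mu]_(x in `[0%R, s]) (f x)%:E +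
     \int[mu]_(x in `[s, +oo[) (f x)%:E)%E.
  move=> f0 mf; rewrite -integral_itv_obnd_cbnd; last first.
    exact/measurable_EFinP/measurable_funTS.
  rewrite -ge0_integral_setU//=.
  - by rewrite -itv_bndbnd_setU// bnd_simp ltW.
  - exact/measurable_EFinP/measurable_funTS.
  - by move=> x _; rewrite lee_fin.
  - apply/disj_setPS => x [] /=; rewrite !in_itv/= => /andP[_ xs].
    by rewrite andbT ltNge xs.
transitivity (\int[mu]_x (s ^+ 2 * phi x)%:E)%E.
  rewrite -/phi !ge0_symfun_integralT//; last 2 first.
  - by move=> x /=; rewrite ?sqrrN phiN.
  - by move=> x /=; rewrite ?sqrrN phiN.
  congr *%E; rewrite -set_itvcy split// split// inner outer.
  by rewrite addeAC -addeA addeC.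
under eq_integral do rewrite EFinM.
rewrite integralZl//; last exact: integrable_normal_pdf.
by rewrite integral_normal_pdf mule1.
Qed.

End normal_second_moment.

(** * Moments of Gaussian laws *)

Section normal_moments.
Context d (T : measurableType d) (R : realType) (P : probability T R).
Implicit Types (X : {mfun T >-> R}) (m v : R).

Definition has_normal_law X m v :=
  forall A, measurable A -> P (X @^-1` A) = normal_law m v A.

Lemma normal_law_second_moment X m v : 0 < v -> has_normal_law X m v ->
  (\int[P]_w ((X w - m) ^+ 2)%:E = v%:E)%E.
Proof.
move=> v0 XN.
have mf : measurable_fun [set: measurableTypeR R] (fun x => ((x - m) ^+ 2)%:E).
  by apply/measurable_EFinP; apply: measurable_funX; exact: measurable_funB.
transitivity (\int[distribution P X]_x ((x - m) ^+ 2)%:E)%E.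
  by rewrite ge0_integral_distribution// => x; rewrite lee_fin sqr_ge0.
have mg : measurable_fun [set: measurableTypeR R] (fun x => (x ^+ 2)%:E).
  by apply/measurable_EFinP; exact: measurable_funX.
have mshift := @measurable_addr R (- m).
transitivity (\int[pushforward (distribution P X)
    (fun x : measurableTypeR R => (x - m)%R : measurableTypeR R)]_x
    (x ^+ 2)%:E)%E.
  rewrite [RHS]ge0_integral_pushforward//=.
  by move=> x _; rewrite lee_fin sqr_ge0.
transitivity (\int[normal_prob 0 (Num.sqrt v)]_x (x ^+ 2)%:E)%E.
  apply: eq_measure_integral => A mA _ /=.
  rewrite /pushforward.
  transitivity (normal_law m v ((fun x => x - m) @^-1` A)).
    by apply: XN; rewrite -[X in measurable X]setTI; exact: mshift.
  by rewrite normal_law_shift ?ltW// subrr /normal_law gt_eqF.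
rewrite ge0_integral_normal_prob//; last by move=> x; rewrite lee_fin sqr_ge0.
by rewrite -[in RHS](sqr_sqrtr (ltW v0)) -normal_pdf_second_moment ?sqrtr_gt0//.
Qed.

(** |X| <= (X - m)^2 + 1 + |m|, and the right-hand side is integrable. *)
Lemma normal_law_Lfun1 X m v : 0 < v -> has_normal_law X m v ->
  (X : T -> R) \in Lfun P 1.
Proof.
move=> v0 XN.
have i2 : P.-integrable [set: T] (EFin \o (fun w => (X w - m) ^+ 2)).
  apply/integrableP; split.
    apply/measurable_EFinP; apply: measurable_funX; exact: measurable_funB.
  under eq_integral do rewrite /= ger0_norm ?sqr_ge0//.
  by rewrite (normal_law_second_moment v0 XN) ltry.
apply/Lfun1_integrable.
have i3 := integrableD measurableT i2
  (finite_measure_integrable_cst P (1 + `|m|) measurableT).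
apply: le_integrable i3 => //.
- exact/measurable_EFinP.
- move=> w _ /=; rewrite lee_fin.
  rewrite [leRHS]ger0_norm; last by rewrite addr_ge0 ?sqr_ge0// addr_ge0.
  rewrite -{1}[X w](subrK m) (le_trans (ler_normD _ _))// addrA lerD2r.
  rewrite -[in leRHS]real_normK ?num_real//.
  have := sqr_ge0 (`|X w - m| - 2^-1); have := normr_ge0 (X w - m).
  nra.
Qed.

Lemma eq_law_expectation (X Y : {mfun T >-> R}) :
  (forall A, measurable A -> P (X @^-1` A) = P (Y @^-1` A)) ->
  (X : T -> R) \in Lfun P 1 -> (Y : T -> R) \in Lfun P 1 ->
  ('E_P[X] = 'E_P[Y])%E.
Proof.
move=> XY /Lfun1_integrable iX /Lfun1_integrable iY.
have mE : measurable_fun [set: measurableTypeR R] (fun x => x%:E).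
  exact/measurable_EFinP.
rewrite unlock; transitivity (\int[distribution P X]_x x%:E)%E.
  by rewrite integral_distribution.
transitivity (\int[distribution P Y]_x x%:E)%E.
  by apply: eq_measure_integral => A mA _; exact: XY.
by rewrite integral_distribution.
Qed.

End normal_moments.

Section gaussian_moments.
Context {R : realType} {n : nat}.
Implicit Types (Q : probability (n.-tuple R) R).
Implicit Types (a mu : 'cV[R]_n) (Sigma : 'M[R]_n).

Definition linear_functional a (y : n.-tuple R) : R :=
  \sum_i a i 0 * tnth y i.

Lemma measurable_linear_functional a :
  measurable_fun [set: n.-tuple R] (linear_functional a).
Proof.
apply: measurable_sum => i; apply: measurable_funM => //.
exact: measurable_tnth.
Qed.

HB.instance Definition _ a :=
  isMeasurableFun.Build _ _ _ _ _ (measurable_linear_functional a).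

(** With X = a^T Y and m = a^T mu, both - X = (- a)^T Y and X - 2 m have
    the law N(- m, a^T Sigma a), so - E X = E X - 2 m. *)
Lemma gaussian_expectation Q mu Sigma a : is_gaussian Q mu Sigma ->
  0 < (a^T *m Sigma *m a) 0 0 ->
  'E_Q[linear_functional a]%E = ((a^T *m mu) 0 0)%:E.
Proof.
move=> gQ; set v : R := (_ *m a) 0 0; set m : R := (_ *m mu) 0 0 => v0.
have aN : has_normal_law Q (linear_functional a) m v by exact: gQ.
have NaE y : linear_functional (- a) y = - linear_functional a y.
  rewrite /linear_functional -sumrN.
  by apply: eq_bigr => i _; rewrite mxE mulNr.
have NaN : has_normal_law Q (linear_functional (- a)) (- m) v.
  have Em : ((- a)^T *m mu) 0 0 = - m by rewrite linearN/= mulNmx mxE.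
  have Ev : ((- a)^T *m Sigma *m - a) 0 0 = v.
    by rewrite mulmxN linearN/= !mulNmx opprK.
  by rewrite -Em -Ev; exact: gQ.
have L1 := normal_law_Lfun1 v0 aN; have NL1 := normal_law_Lfun1 v0 NaN.
have E := expectation_fin_num L1.
pose Y : {mfun n.-tuple R >-> R} := (linear_functional a \- cst (m *+ 2))%R.
have L1Y : (Y : _ -> R) \in Lfun Q 1 by rewrite rpredB// Lfun_cst.
have : ('E_Q[linear_functional (- a)] =
    'E_Q[(linear_functional a \- cst (m *+ 2))%R])%E.
  apply: (eq_law_expectation (Y := Y)) => // A mA.
  rewrite NaN// (_ : - m = m - m *+ 2); last by ring.
  rewrite -normal_law_shift ?ltW// -aN//.
  by rewrite -[X in measurable X]setTI; exact: measurable_addr.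
have -> : linear_functional (- a) = cst 0 \- linear_functional a.
  by apply/funext => y /=; rewrite NaE sub0r.
rewrite !expectationB ?Lfun_cst// !expectation_cst sub0e.
rewrite -(fineK E) -EFinN -EFinB => -[EN]; congr (_%:E).
lra.
Qed.

Lemma gaussian_variance Q mu Sigma a : is_gaussian Q mu Sigma ->
  0 < (a^T *m Sigma *m a) 0 0 ->
  'V_Q[linear_functional a]%E = ((a^T *m Sigma *m a) 0 0)%:E.
Proof.
move=> gQ v0; have aN : has_normal_law Q (linear_functional a) _ _ := gQ a.
rewrite -(normal_law_second_moment v0 aN) /variance covariance.unlock.
rewrite (gaussian_expectation gQ v0) expectation.unlock/=.
by apply: eq_integral => y _; rewrite expr2.
Qed.

Lemma linear_functional_delta i :
  linear_functional (delta_mx i 0) = fun y => tnth y i.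
Proof.
apply/funext => y; rewrite /linear_functional (bigD1 i)//= mxE !eqxx mul1r.
by rewrite big1 ?addr0// => j ji; rewrite mxE (negbTE ji) mul0r.
Qed.

Lemma gaussian_marginal_mean Q mu Sigma i : is_gaussian Q mu Sigma ->
  0 < Sigma i i -> marginal_mean Q i = mu i 0.
Proof.
move=> gQ v0; rewrite /marginal_mean -linear_functional_delta.
rewrite (gaussian_expectation gQ); first by rewrite trmx_delta -rowE mxE.
by rewrite trmx_delta -rowE -colE !mxE.
Qed.

Lemma gaussian_marginal_variance Q mu Sigma i : is_gaussian Q mu Sigma ->
  0 < Sigma i i -> marginal_variance Q i = Sigma i i.
Proof.
move=> gQ v0; rewrite /marginal_variance -linear_functional_delta.
have E : ((delta_mx i 0)^T *m Sigma *m delta_mx i 0 : 'M[R]_1) 0 0 = Sigma i i.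
  by rewrite trmx_delta -rowE -colE !mxE.
by rewrite (gaussian_variance gQ) E.
Qed.

(** Means of the coordinates and variances of all linear functionals are
    determined by [Q]; polarization recovers the off-diagonal entries. *)
Lemma gaussian_inj Q mu mu' Sigma Sigma' : posdefmx Sigma -> posdefmx Sigma' ->
  is_gaussian Q mu Sigma -> is_gaussian Q mu' Sigma' ->
  mu = mu' /\ Sigma = Sigma'.
Proof.
move=> pd pd' gQ gQ'; split.
  apply/colP => i; rewrite -(gaussian_marginal_mean gQ) ?posdefmx_diag//.
  by rewrite -(gaussian_marginal_mean gQ') ?posdefmx_diag.
have qE (a : 'rV[R]_n) : (a *m Sigma *m a^T) 0 0 = (a *m Sigma' *m a^T) 0 0.
  have [->|a0] := eqVneq a 0; first by rewrite !mul0mx.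
  have a0' : a^T != 0 by rewrite trmx_eq0.
  have := gaussian_variance gQ (pd.2 _ a0').
  by rewrite (gaussian_variance gQ' (pd'.2 _ a0')) trmxK => -[].
apply/matrixP => i j.
have := qE (delta_mx 0 i + 1 *: delta_mx 0 j).
rewrite (quadD _ _ _ pd.1) (quadD _ _ _ pd'.1) !qE !mulr1 => /addIr/addrI.
rewrite trmx_delta -!rowE -!colE !mxE => H.
by apply: (@mulfI _ 2).
Qed.

End gaussian_moments.

(** * The privacy guarantee *)

Lemma DS_score_loss_le (R : realType) (n : nat) (r1 r2 : R)
    (Q : probability (n.-tuple R) R) (x : n.-tuple R) (i : 'I_n) :
  (1 < n)%N -> 0 < r2 -> gaussian_priors r1 r2 x Q ->
  DS_score i Q x - DS_score i (average_posterior Q (average x)) x <= r1 + ln r2.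
Proof.
move=> n1 r20 [mu [Sigma [pd gQ hd hc]]].
have [mu' [Sigma' [pd' gQ' gP]]] :=
  average_posteriorP (average x) (ltnW n1) pd gQ.
have [muE SigmaE] := gaussian_inj pd' pd gQ' gQ.
move: gP; rewrite {}muE {}SigmaE {mu' Sigma' pd' gQ'} => gP.
have V0 := posdefmx_diag i pd.
have le_V := prior_le_posterior_variance i n1 pd hc.
have P0 : 0 < posterior_covariance Sigma i i.
  by rewrite -(pmulr_rgt0 _ r20) (lt_le_trans V0).
rewrite /DS_score.
rewrite (gaussian_marginal_mean gQ V0) (gaussian_marginal_variance gQ V0).
rewrite (gaussian_marginal_mean gP P0) (gaussian_marginal_variance gP P0).
have := score_loss_le (tnth x i - mu i 0) (average x - mean_average mu)
  V0 (quad_averaging_gt0 (ltnW n1) pd) P0 (posterior_variance i pd).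
rewrite -variance_averageE => loss.
have -> : posterior_mean mu Sigma (average x) i 0 = mu i 0 +
    (Sigma *m averaging_vector) i 0 * (average x - mean_average mu)
      / variance_average Sigma.
  by rewrite /posterior_mean -variance_averageE 2!mxE mulrC mulrA.
have ln_le : ln (Sigma i i) <= ln r2 + ln (posterior_covariance Sigma i i).
  by rewrite -lnM ?posrE// ler_ln ?posrE// mulr_gt0.
rewrite [_ - (mu i 0 + _)](_ : _ = tnth x i - mu i 0 -
  (Sigma *m averaging_vector) i 0 * (average x - mean_average mu)
    / variance_average Sigma); last by ring.
have := le_trans loss hd; lra.
Qed.

Theorem proposition7 (R : realType) (n : nat) (r1 r2 : R)
  (hn : (2 <= n)%N) (hr1 : 0 < r1) (hr2 : 1 < r2) :
  persuasively_private (@average_mechanism R n) average_posterior DS_scores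
    (gaussian_priors r1 r2) (r1 + ln r2) 0.
Proof.
rewrite /persuasively_private subr0.
apply: le_ereal_inf_tmp => _ [_ [i _ <-] <-].
apply: le_ereal_inf_tmp => _ [x _ <-].
apply: le_ereal_inf_tmp => _ [Q prior <-].
rewrite /average_mechanism /= /kdirac /= diracE mem_set//=.
by apply: DS_score_loss_le => //; exact: lt_trans hr2.
Qed.
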